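(* There exists a parabolic semigroup $(\phi_t)$ of zero hyperbolic step in $\mathbb{D}$ such that for every $z\in \mathbb{D}$, the slope of $(\phi_t)$ (computed along the trajectory of $z$) is $[a,b]$ with $-\pi/2<a<b<\pi/2$.
   Context: $\mathbb{D}=\{z\in\mathbb{C}:|z|<1\}$. A semigroup in $\mathbb{D}$ is a family $(\phi_t)_{t\ge0}$ of holomorphic self-maps of $\mathbb{D}$ with $\phi_0=\mathrm{id}$, $\phi_{s+t}=\phi_s\circ\phi_t$, and $t\mapsto\phi_t$ continuous for uniform convergence on compacta. If it is not a group of hyperbolic rotations, there is a unique $\tau\in\overline{\mathbb{D}}$, the Denjoy-Wolff point, with $\lim_{t\to+\infty}\phi_t(z)=\tau$ for all $z\in\mathbb{D}$. $(\phi_t)$ is parabolic of zero hyperbolic step if and only if there is a univalent (injective holomorphic) function $h:\mathbb{D}\to\mathbb{C}$ such that $h(\mathbb{D})+it\subset h(\mathbb{D})$ for all $t\ge 0$, $h(\phi_t(z))=h(z)+it$ for all $t\ge0$, $z\in\mathbb{D}$, and for every $w\in\mathbb{C}$ there is $t_0\ge0$ with $w+it_0\in h(\mathbb{D})$. In that case $\tau\in\partial\mathbb{D}$. The slope of $(\phi_t)$ is the cluster set of $\operatorname{Arg}(1-\overline{\tau}\phi_t(z))$ as $t\to+\infty$, a compact subset of $[-\pi/2,\pi/2]$ which does not depend on $z\in\mathbb{D}$. *)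

(* Defs.v *)
From Stdlib Require Import Reals List Lra.
From Coquelicot Require Import Coquelicot.
Open Scope R_scope.

Definition unit_disk (z : C) : Prop := Cmod z < 1.

(* [ex_derive] at type [C -> C] is complex differentiability. *)
Definition holomorphic_on (D : C -> Prop) (f : C -> C) : Prop :=
  forall z : C, D z -> ex_derive f z.

Definition univalent_on (D : C -> Prop) (f : C -> C) : Prop :=
  holomorphic_on D f /\
  (forall z w : C, D z -> D w -> f z = f w -> z = w).

Definition compact_set {T : UniformSpace} (K : T -> Prop) : Prop :=
  forall (I : Type) (U : I -> T -> Prop),
    (forall i, open (U i)) ->
    (forall x, K x -> exists i, U i x) ->
    exists l : list I, forall x, K x -> exists i, In i l /\ U i x.

(* A map of the disk is represented by a total map on [C], and the family by a
   map on all of [R]; values at negative times or off the disk play no role. *)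
Record semigroup_in_disk (phi : R -> C -> C) : Prop := {
  semigroup_self : forall t, 0 <= t ->
    forall z, unit_disk z -> unit_disk (phi t z);
  semigroup_holo : forall t, 0 <= t -> holomorphic_on unit_disk (phi t);
  semigroup_id : forall z, unit_disk z -> phi 0 z = z;
  semigroup_add : forall s t, 0 <= s -> 0 <= t ->
    forall z, unit_disk z -> phi (s + t) z = phi s (phi t z);
  semigroup_cont : forall t0, 0 <= t0 ->
    forall K : C -> Prop, compact_set K -> (forall z, K z -> unit_disk z) ->
    forall eps : posreal, exists delta : posreal,
    forall t, 0 <= t -> Rabs (t - t0) < delta ->
    forall z, K z -> Cmod (phi t z - phi t0 z)%C < eps
}.

Definition denjoy_wolff_point (phi : R -> C -> C) (tau : C) : Prop :=
  Cmod tau <= 1 /\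
  (forall z, unit_disk z ->
     filterlim (fun t => phi t z) (Rbar_locally p_infty) (locally tau)).

(* Parabolicity with zero hyperbolic step is expressed through the Koenigs
   function [h], whose image is invariant under upward vertical translations,
   the translates [h(D) - it] exhausting the plane. *)
Definition parabolic_zero_hyperbolic_step (phi : R -> C -> C) : Prop :=
  semigroup_in_disk phi /\
  exists h : C -> C,
    univalent_on unit_disk h /\
    (forall t, 0 <= t -> forall z, unit_disk z ->
       exists z', unit_disk z' /\ h z' = (h z + Ci * t)%C) /\
    (forall t, 0 <= t -> forall z, unit_disk z ->
       h (phi t z) = (h z + Ci * t)%C) /\
    (forall w : C, exists t0, 0 <= t0 /\
       exists z, unit_disk z /\ h z = (w + Ci * t0)%C).

(* Principal argument, in (-PI, PI]; its value at 0 is irrelevant. *)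
Definition Arg (z : C) : R :=
  if Rle_dec 0 (Im z) then acos (Re z / Cmod z) else - acos (Re z / Cmod z).

Lemma Arg_spec (z : C) : z <> 0%C ->
  - PI < Arg z <= PI /\
  z = (Cmod z * cos (Arg z), Cmod z * sin (Arg z)).
Proof.
  intros Hz.
  assert (Hm : 0 < Cmod z) by now apply Cmod_gt_0.
  assert (Hsq : Cmod z * Cmod z = Re z * Re z + Im z * Im z).
  { unfold Cmod, Re, Im. rewrite sqrt_sqrt; [unfold pow; ring |]. apply Rplus_le_le_0_compat; apply pow2_ge_0. }
  set (m := Cmod z) in *.
  set (c := Re z / m).
  assert (Hc : Re z = m * c) by (unfold c; field; lra).
  assert (Hb : -1 <= c <= 1).
  { assert (Hd : m * m * (1 - c * c) = Im z * Im z) by (rewrite Hc in Hsq; lra).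
    assert (Hmm : 0 < m * m) by nra.
    assert (Hle : c * c <= 1).
    { destruct (Rle_lt_dec (c * c) 1) as [| Hlt]; [assumption | exfalso].
      assert (0 < c * c - 1) by lra.
      assert (0 < m * m * (c * c - 1)) by now apply Rmult_lt_0_compat.
      nra. }
    nra. }
  assert (Hs : m * sqrt (1 - c * c) = Rabs (Im z)).
  { apply Rsqr_inj.
    - apply Rmult_le_pos; [lra | apply sqrt_pos].
    - apply Rabs_pos.
    - rewrite <- Rsqr_abs. unfold Rsqr.
      replace (m * sqrt (1 - c * c) * (m * sqrt (1 - c * c)))
        with (m * m * (sqrt (1 - c * c) * sqrt (1 - c * c))) by ring.
      rewrite sqrt_sqrt by nra. nra. }
  pose proof (acos_bound c) as Ha.
  assert (Hz2 : z = (Re z, Im z)) by now destruct z.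
  unfold Arg. fold m. fold c.
  destruct (Rle_dec 0 (Im z)) as [Hi | Hi].
  - split; [pose proof PI_RGT_0; lra |].
    rewrite cos_acos, sin_acos by lra. unfold Rsqr.
    rewrite Hs, Rabs_pos_eq, <- Hc by lra. exact Hz2.
  - split.
    + split; [| pose proof PI_RGT_0; lra].
      enough (acos c <> PI) by lra.
      intros E. assert (Ec : c = -1) by (rewrite <- (cos_acos c), E by lra; apply cos_PI).
      rewrite Ec in Hs.
      replace (1 - -1 * -1) with 0 in Hs by ring.
      rewrite sqrt_0, Rabs_left in Hs by lra. lra.
    + rewrite cos_neg, sin_neg, cos_acos, sin_acos by lra. unfold Rsqr.
      replace (m * - sqrt (1 - c * c)) with (- (m * sqrt (1 - c * c))) by ring.
      rewrite Hs, Rabs_left, Ropp_involutive, <- Hc by lra. exact Hz2.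
Qed.

Definition cluster_set_at_infty (f : R -> R) (x : R) : Prop :=
  forall (eps : posreal) (T : R), exists t, T <= t /\ Rabs (f t - x) < eps.

Definition slope (phi : R -> C -> C) (tau z : C) : R -> Prop :=
  cluster_set_at_infty (fun t => Arg (1 - Cconj tau * phi t z)%C).

(* Main.v *)
Require Import Defs.
From Stdlib Require Import Reals Ranalysis5 Lra Lia ClassicalEpsilon.
From Coquelicot Require Import Coquelicot.

(** The coordinate [v = 1 / (1 - z)] maps the disk onto the half plane [Re v > 1/2] and the
    boundary point [1], which will be the Denjoy-Wolff point, to infinity; moreover
    [1 - z = 1 / v], so the slope is governed by the argument of [v] along trajectories. A
    semigroup is specified by an injective map [k] of the half plane whose range is stable
    under translation by positive reals: the trajectories [v(t)] solve [k(v(t)) = k(v(0)) + t].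

    The map chosen is [k(v) = v + c v^(1+i)] with a small [c > 0] ([koenigs_Omega]). Since
    [v^i] has modulus [e^(- arg v)], which is bounded, and argument [ln |v|], which goes on
    rotating as [v] tends to infinity, [k(v)] and [v] differ in direction by an angle that
    oscillates forever. On a trajectory [k(v(t))] becomes asymptotic to the positive real
    direction, and the argument of [v(t)] has to compensate for the oscillation. Precisely,
    with [x = ln |v|] and [y = arg v],

      [Im k(v) / |v| = sin y + c e^(-y) sin (x + y)].

    The left-hand side tends to [0] on a trajectory, because [Im k] is constant there and [|v|]
    tends to infinity; therefore [e^y sin y + c sin (x + y)] tends to [0]
    ([trajectory_exp_sin_limit]). The phase [x + y] is continuous and unbounded, so its sine takes
    every value of [[-1, 1]] at arbitrarily late times. As [y |-> e^y sin y] is increasing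
    near [0], the cluster set of [y] is the interval [[a, b]] with [e^a sin a = - c] and
    [e^b sin b = c], whatever the starting point ([cluster_set_interval]). The slope is
    [[-b, -a]].

    That [k] defines a semigroup is a perturbation argument. The derivative of [c v^(1+i)] is
    at most [1/3] in modulus on the right half plane, so [k] is the identity plus a
    1/3-contraction. It is therefore bi-Lipschitz, in particular injective, and the contraction
    principle solves [k(w) = k(v) + T] inside the half plane as soon as [|T| <= 2 Re T]
    ([perturbed_identity_solvable]). Positive [T] give the flow; [T = a + t] with [t] large
    shows that the translates of the range exhaust the plane, that is, that the
    hyperbolic step is zero. The flow is Lipschitz in time and space because the inverse of [k]
    is, and holomorphic by implicit differentiation. *)

Open Scope R_scope.

(** * Complex derivatives *)

(** Complex differentiability of [f] at [z] with derivative [l], in epsilon form: the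
    topologies that [is_derive] puts on source and target do not enter, which makes
    composition and implicit differentiation direct. *)
Definition has_cderiv (f : C -> C) (z l : C) : Prop :=
  forall eps, 0 < eps -> exists d, 0 < d /\ forall w, Cmod (w - z) < d ->
    Cmod (f w - f z - l * (w - z)) <= eps * Cmod (w - z).

Lemma has_cderiv_ex_derive f z l : has_cderiv f z l -> ex_derive f z.
Proof.
  intros H. exists l. split.
  - apply is_linear_scal_l.
  - intros x Hx.
    assert (E : z = x)
      by exact (is_filter_lim_locally_unique (V := AbsRing_NormedModule C_AbsRing) z x Hx).
    subst x.
    intros eps. destruct (H eps (cond_pos eps)) as [d [Hd Hw]].
    exists (mkposreal d Hd). intros w Hb.
    generalize (Hw w Hb).
    replace (l * (w - z))%C with ((w - z) * l)%C by ring.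
    exact (fun x => x).
Qed.

Definition eps_continuous_at (f : C -> C) (z : C) : Prop :=
  forall eps, 0 < eps -> exists d, 0 < d /\ forall w, Cmod (w - z) < d -> Cmod (f w - f z) < eps.

Lemma Cmod_triangle_rev x y : Cmod x - Cmod y <= Cmod (x + y).
Proof.
  generalize (Cmod_triangle (x + y) (- y)). rewrite Cmod_opp.
  replace (x + y + - y)%C with x by ring. lra.
Qed.

Lemma has_cderiv_bound f z l : has_cderiv f z l ->
  exists d, 0 < d /\ forall w, Cmod (w - z) < d -> Cmod (f w - f z) <= (Cmod l + 1) * Cmod (w - z).
Proof.
  intros H. destruct (H 1 Rlt_0_1) as [d [Hd Hw]]. exists d; split; auto.
  intros w W. specialize (Hw w W).
  replace (f w - f z)%C with (f w - f z - l * (w - z) + l * (w - z))%C by ring.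
  eapply Rle_trans; [apply Cmod_triangle|]. rewrite (Cmod_mult l). lra.
Qed.

Lemma has_cderiv_const a z : has_cderiv (fun _ => a) z 0.
Proof.
  intros eps He. exists 1; split; [lra|]. intros w _.
  replace (a - a - 0 * (w - z))%C with (RtoC 0) by ring. rewrite Cmod_0.
  generalize (Cmod_ge_0 (w - z)). nra.
Qed.

Lemma has_cderiv_id z : has_cderiv (fun w => w) z 1.
Proof.
  intros eps He. exists 1; split; [lra|]. intros w _.
  replace (w - z - 1 * (w - z))%C with (RtoC 0) by ring. rewrite Cmod_0.
  generalize (Cmod_ge_0 (w - z)). nra.
Qed.

Lemma has_cderiv_plus f g z l m : has_cderiv f z l -> has_cderiv g z m ->
  has_cderiv (fun w => f w + g w)%C z (l + m).
Proof.
  intros Hf Hg eps He.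
  destruct (Hf (eps / 2)) as [d [Hd H1]]; [lra|].
  destruct (Hg (eps / 2)) as [e [He' H2]]; [lra|].
  exists (Rmin d e); split; [now apply Rmin_glb_lt|]. intros w W.
  specialize (H1 w (Rlt_le_trans _ _ _ W (Rmin_l _ _))).
  specialize (H2 w (Rlt_le_trans _ _ _ W (Rmin_r _ _))).
  replace (f w + g w - (f z + g z) - (l + m) * (w - z))%C with
    ((f w - f z - l * (w - z)) + (g w - g z - m * (w - z)))%C by ring.
  eapply Rle_trans; [apply Cmod_triangle|]. lra.
Qed.

Lemma has_cderiv_comp f g z l m : has_cderiv g z m -> has_cderiv f (g z) l ->
  has_cderiv (fun w => f (g w)) z (l * m).
Proof.
  intros Hg Hf eps He.
  destruct (has_cderiv_bound _ _ _ Hg) as [d0 [Hd0 H0]].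
  assert (Hm : 0 < Cmod m + 1) by (generalize (Cmod_ge_0 m); lra).
  assert (Hl : 0 < Cmod l + 1) by (generalize (Cmod_ge_0 l); lra).
  destruct (Hf (eps / 2 / (Cmod m + 1))) as [d1 [Hd1 H1]].
  { apply Rdiv_lt_0_compat; lra. }
  destruct (Hg (eps / 2 / (Cmod l + 1))) as [d2 [Hd2 H2]].
  { apply Rdiv_lt_0_compat; lra. }
  assert (Hd3 : 0 < d1 / (Cmod m + 1)) by (apply Rdiv_lt_0_compat; lra).
  exists (Rmin d0 (Rmin d2 (d1 / (Cmod m + 1)))). split.
  { repeat apply Rmin_glb_lt; auto. }
  intros w W.
  apply Rmin_Rgt in W. destruct W as [W0 W]. apply Rmin_Rgt in W. destruct W as [W2 W1].
  specialize (H0 w W0). specialize (H2 w W2).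
  assert (W3 : Cmod (g w - g z) < d1).
  { eapply Rle_lt_trans; [exact H0|]. apply Rgt_lt in W1.
    apply (Rmult_lt_compat_l (Cmod m + 1)) in W1; [|lra].
    replace ((Cmod m + 1) * (d1 / (Cmod m + 1))) with d1 in W1 by (field; lra). lra. }
  specialize (H1 (g w) W3).
  replace (f (g w) - f (g z) - l * m * (w - z))%C with
   ((f (g w) - f (g z) - l * (g w - g z)) + l * (g w - g z - m * (w - z)))%C by ring.
  eapply Rle_trans; [apply Cmod_triangle|]. rewrite (Cmod_mult l).
  assert (A : Cmod (f (g w) - f (g z) - l * (g w - g z)) <= eps / 2 * Cmod (w - z)).
  { eapply Rle_trans; [exact H1|].
    apply Rle_trans with (eps / 2 / (Cmod m + 1) * ((Cmod m + 1) * Cmod (w - z))).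
    - apply Rmult_le_compat_l; [|exact H0]. apply Rlt_le, Rdiv_lt_0_compat; lra.
    - right. field. lra. }
  assert (B : Cmod l * Cmod (g w - g z - m * (w - z)) <= eps / 2 * Cmod (w - z)).
  { apply Rle_trans with ((Cmod l + 1) * (eps / 2 / (Cmod l + 1) * Cmod (w - z))).
    - apply Rmult_le_compat; try apply Cmod_ge_0; lra.
    - right. field. lra. }
  lra.
Qed.

Lemma has_cderiv_scal a z : has_cderiv (fun w => a * w)%C z a.
Proof.
  intros eps He. exists 1; split; [lra|]. intros w _.
  replace (a * w - a * z - a * (w - z))%C with (RtoC 0) by ring. rewrite Cmod_0.
  generalize (Cmod_ge_0 (w - z)). nra.
Qed.

Lemma has_cderiv_inv (z : C) : z <> 0%C -> has_cderiv Cinv z (- / (z * z)).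
Proof.
  intros Hz eps He. assert (Hm := proj1 (Cmod_gt_0 z) Hz).
  set (m := Cmod z) in *.
  exists (Rmin (m / 2) (eps * m * m * m / 2)). split.
  { apply Rmin_glb_lt; [lra|]. unfold Rdiv. repeat apply Rmult_lt_0_compat; lra. }
  intros w W. apply Rmin_Rgt in W. destruct W as [W1 W2].
  assert (Hw : m / 2 < Cmod w).
  { generalize (Cmod_triangle_rev z (w - z)). fold m. replace (z + (w - z))%C with w by ring. lra. }
  assert (Hw0 : w <> 0%C) by (apply Cmod_gt_0; lra).
  replace (/ w - / z - - / (z * z) * (w - z))%C with ((w - z) * ((w - z) / (w * (z * z))))%C
    by (field; auto).
  rewrite Cmod_mult, Cmod_div, !Cmod_mult by (repeat apply Cmult_neq_0; auto). fold m.
  rewrite (Rmult_comm eps). apply Rmult_le_compat_l; [apply Cmod_ge_0|].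
  apply Rle_div_l.
  - repeat apply Rmult_lt_0_compat; lra.
  - apply Rle_trans with (eps * m * m * m / 2); [lra|].
    assert (eps * m * m * (m / 2) <= eps * m * m * Cmod w).
    { apply Rmult_le_compat_l; [|lra]. repeat apply Rmult_le_pos; lra. }
    lra.
Qed.

(** If [G (f w) = F w] near [z] and [G] has a nonzero derivative at [f z], continuity of [f]
    already forces differentiability: the increments satisfy
    [l * (f w - f z) ~ m * (w - z)]. Used for the logarithm ([G] the exponential) and for
    the flow ([G] the linearizing map). *)
Lemma has_cderiv_implicit G F f z l m :
  has_cderiv G (f z) l -> l <> 0%C -> has_cderiv F z m -> eps_continuous_at f z ->
  (exists d, 0 < d /\ forall w, Cmod (w - z) < d -> G (f w) = F w) ->
  has_cderiv f z (m / l).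
Proof.
  intros HG Hl HF Hc [d0 [Hd0 E]] eps He.
  assert (Hml := proj1 (Cmod_gt_0 l) Hl).
  assert (Ez : G (f z) = F z).
  { apply E. replace (z - z)%C with (RtoC 0) by ring. rewrite Cmod_0. exact Hd0. }
  destruct (has_cderiv_bound _ _ _ HF) as [d1 [Hd1 H1]].
  set (M := Cmod m + 1) in *. assert (HM : 1 <= M) by (unfold M; generalize (Cmod_ge_0 m); lra).
  set (k := Cmod l) in *.
  (* The bound k/2 makes f Lipschitz near z with constant 2M/k; the other one turns the
     error e1 * |f w - f z| into at most half of the allowed error. *)
  set (e1 := Rmin (k / 2) (eps * k * k / (4 * M))).
  assert (He1 : 0 < e1).
  { apply Rmin_glb_lt; [lra|]. apply Rdiv_lt_0_compat; [|lra]. repeat apply Rmult_lt_0_compat; lra.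
    }
  destruct (HG e1 He1) as [d2 [Hd2 H2]].
  destruct (Hc d2 Hd2) as [d3 [Hd3 H3]].
  destruct (HF (eps * k / 2)) as [d4 [Hd4 H4]].
  { unfold Rdiv. repeat apply Rmult_lt_0_compat; lra. }
  exists (Rmin (Rmin d0 d1) (Rmin d3 d4)). split; [repeat apply Rmin_glb_lt; auto|].
  intros w W. apply Rmin_Rgt in W. destruct W as [W W'].
  apply Rmin_Rgt in W; apply Rmin_Rgt in W'. destruct W as [W0 W1]. destruct W' as [W3 W4].
  specialize (H1 w W1). specialize (H3 w W3). specialize (H2 _ H3). specialize (H4 w W4).
  rewrite (E w W0), Ez in H2.
  set (r := Cmod (w - z)) in *. set (q := Cmod (f w - f z)) in *.
  assert (Hr : 0 <= r) by apply Cmod_ge_0. assert (Hq : 0 <= q) by apply Cmod_ge_0.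
  assert (Hkq : k * q <= e1 * q + M * r).
  { unfold k, q. rewrite <- Cmod_mult.
    replace (l * (f w - f z))%C with (- (F w - F z - l * (f w - f z)) + (F w - F z))%C by ring.
    eapply Rle_trans; [apply Cmod_triangle|]. rewrite Cmod_opp. fold q. lra. }
  assert (Hq2 : q <= 2 * M * r / k).
  { apply Rle_div_r; [lra|]. assert (e1 <= k / 2) by apply Rmin_l. nra. }
  apply Rmult_le_reg_l with k; [lra|].
  unfold k at 1. rewrite <- Cmod_mult.
  replace (l * (f w - f z - m / l * (w - z)))%C with
   (- (F w - F z - l * (f w - f z)) + (F w - F z - m * (w - z)))%C by (field; auto).
  eapply Rle_trans; [apply Cmod_triangle|]. rewrite Cmod_opp.
  assert (e1 * q <= eps * k / 2 * r).
  { apply Rle_trans with (eps * k * k / (4 * M) * (2 * M * r / k)).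
    - apply Rmult_le_compat; try lra. apply Rmin_r.
    - right. field. lra. }
  lra.
Qed.

(** * Exponential, logarithm and powers on the right half plane *)

Definition cexp (z : C) : C := (exp (Re z) * cos (Im z), exp (Re z) * sin (Im z)).

Lemma cexp_plus z w : cexp (z + w) = (cexp z * cexp w)%C.
Proof.
  destruct z as [a b], w as [c d]. unfold cexp, Cmult, Cplus, Re, Im; simpl.
  rewrite exp_plus, cos_plus, sin_plus. f_equal; ring.
Qed.

Lemma Cmod_cexp z : Cmod (cexp z) = exp (Re z).
Proof.
  unfold Cmod, cexp; simpl.
  transitivity (sqrt (exp (Re z) * exp (Re z))); [|apply sqrt_square; left; apply exp_pos].
  f_equal. generalize (sin2_cos2 (Im z)). unfold Rsqr. nra.
Qed.

Lemma cexp_neq_0 z : cexp z <> 0%C.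
Proof. apply Cmod_gt_0. rewrite Cmod_cexp. apply exp_pos. Qed.

Lemma exp_taylor a : Rabs a <= 1/2 -> 0 <= exp a - 1 - a <= 2 * (a * a).
Proof.
  intros H. apply Rabs_le_between in H.
  assert (H1 := exp_ineq1_le a). assert (H2 := exp_ineq1_le (- a)).
  assert (E : exp a * exp (- a) = 1) by (rewrite <- exp_plus, Rplus_opp_r; apply exp_0).
  assert (P := exp_pos a). split; [lra|].
  assert (exp a * (1 - a) <= 1) by nra.
  assert (exp a - 1 - a <= a * a / (1 - a)).
  { apply Rle_div_r; lra || nra. }
  assert (a * a / (1 - a) <= 2 * (a * a)).
  { apply Rle_div_l; nra. }
  lra.
Qed.

(** From [1 - cos b = 2 sin(b/2)^2] and [|sin x| <= |x|]. *)
Lemma cos_taylor b : 0 <= 1 - cos b <= b * b / 2.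
Proof.
  split; [generalize (COS_bound b); lra|].
  replace b with (2 * (b / 2)) at 1 by field. rewrite cos_2a_sin.
  assert (forall x, 0 <= x -> sin x * sin x <= x * x).
  { intros x Hx. assert (Rabs (sin x) <= x).
    { apply Rabs_le. split.
      - destruct (Rle_lt_dec x PI).
        + generalize (sin_ge_0 x Hx r). lra.
        + generalize (SIN_bound x) PI2_1. lra.
      - destruct Hx as [Hx|<-]; [left; now apply sin_lt_x| rewrite sin_0; lra]. }
    apply Rabs_le_between in H. nra. }
  assert (sin (b/2) * sin (b/2) <= (b/2) * (b/2)).
  { destruct (Rle_lt_dec 0 b) as [Hb|Hb].
    - apply H; lra.
    - replace (b / 2) with (- (- b / 2)) by field. rewrite sin_neg.
      specialize (H (- b / 2) ltac:(lra)). lra. }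
  lra.
Qed.

Lemma sin_taylor b : Rabs b <= 1 -> Rabs (sin b - b) <= b * b.
Proof.
  intros Hb.
  destruct (MVT_gen (fun x => sin x - x) 0 b (fun x => cos x - 1)) as [c [Hc E]].
  - intros x _. auto_derive; auto. ring.
  - intros x _. apply continuity_pt_minus;
    [apply continuity_sin| apply derivable_continuous_pt, derivable_pt_id].
  - rewrite sin_0 in E. replace (sin b - b) with ((cos c - 1) * b) by lra.
    rewrite Rabs_mult. generalize (cos_taylor c). intros H.
    rewrite (Rabs_left1 (cos c - 1)) by lra.
    replace (b * b) with (Rabs b * Rabs b) by (rewrite <- Rabs_mult; apply Rabs_right; nra).
    apply Rmult_le_compat_r; [apply Rabs_pos|].
    assert (Rabs c <= Rabs b).
    { unfold Rmin, Rmax in Hc; destruct (Rle_dec 0 b); unfold Rabs;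
      destruct (Rcase_abs b), (Rcase_abs c); lra. }
    assert (c * c = Rabs c * Rabs c) by (rewrite <- Rabs_mult; symmetry; apply Rabs_right; nra).
    generalize (Rabs_pos c). nra.
Qed.

Lemma Cmod_le_Re_Im z : Cmod z <= Rabs (Re z) + Rabs (Im z).
Proof.
  destruct z as [a b]. change (Cmod (a, b) <= Rabs a + Rabs b).
  replace (a, b) with (RtoC a + Ci * RtoC b)%C.
  - eapply Rle_trans; [apply Cmod_triangle|].
    rewrite Cmod_mult, Cmod_Ci, !Cmod_R. rewrite Rmult_1_l. apply Rle_refl.
  - unfold Cplus, Cmult, Ci, RtoC; simpl; f_equal; ring.
Qed.

Lemma Im_le_Cmod z : Rabs (Im z) <= Cmod z.
Proof. eapply Rle_trans; [apply Rmax_r|apply Rmax_Cmod]. Qed.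

(** Real and imaginary part reduce to the real estimates
    [e^a = 1 + a + O(a^2)], [cos b = 1 + O(b^2)] and [sin b = b + O(b^2)]. *)
Lemma cexp_taylor h : Cmod h <= 1/2 -> Cmod (cexp h - 1 - h) <= 8 * (Cmod h * Cmod h).
Proof.
  intros Hh. assert (Ha := re_le_Cmod h). assert (Hb := Im_le_Cmod h).
  eapply Rle_trans; [apply Cmod_le_Re_Im|].
  destruct h as [a b]. set (r := Cmod (a, b)) in *. unfold cexp. simpl in *.
  assert (A : a * a <= r * r).
  { apply Rabs_le_between in Ha. assert (0 <= r) by apply Cmod_ge_0. nra. }
  assert (B : b * b <= r * r).
  { apply Rabs_le_between in Hb. assert (0 <= r) by apply Cmod_ge_0. nra. }
  assert (Ea := exp_taylor a ltac:(lra)). assert (Cb := cos_taylor b).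
  assert (Sb := sin_taylor b ltac:(lra)).
  assert (X : exp a <= 2).
  { assert (a <= 1/2) by (generalize (Rle_abs a); lra).
    assert (0 <= r) by apply Cmod_ge_0. assert (a * a <= 1/4) by nra. lra. }
  assert (P := exp_pos a).
  assert (H1 : Rabs (exp a * cos b + -1 + - a) <= 4 * (r * r)).
  { replace (exp a * cos b + - 1 + - a) with ((exp a - 1 - a) - exp a * (1 - cos b)) by ring.
    assert (0 <= exp a * (1 - cos b) <= 2 * (b * b / 2)).
    { split; [apply Rmult_le_pos|apply Rmult_le_compat]; lra. }
    apply Rabs_le. lra. }
  assert (H2 : Rabs (exp a * sin b + -0 + - b) <= 4 * (r * r)).
  { replace (exp a * sin b + -0 + - b) with (exp a * (sin b - b) + (exp a - 1) * b) by ring.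
    eapply Rle_trans; [apply Rabs_triang|]. rewrite !Rabs_mult, (Rabs_right (exp a)) by lra.
    assert (Rabs (exp a - 1) <= 2 * r).
    { replace (exp a - 1) with ((exp a - 1 - a) + a) by ring.
      eapply Rle_trans; [apply Rabs_triang|]. rewrite Rabs_right by lra.
      assert (0 <= r) by apply Cmod_ge_0. nra. }
    assert (Rabs (exp a - 1) * Rabs b <= 2 * r * r).
    { apply Rmult_le_compat; auto using Rabs_pos. }
    assert (exp a * Rabs (sin b - b) <= 2 * (r * r)).
    { apply Rmult_le_compat; try lra; apply Rabs_pos. }
    lra. }
  apply Rle_trans with (4 * (r * r) + 4 * (r * r)); [|lra].
  apply Rplus_le_compat; [exact H1 | exact H2].
Qed.

Lemma has_cderiv_cexp z : has_cderiv cexp z (cexp z).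
Proof.
  intros eps He. set (m := Cmod (cexp z)).
  assert (Hm : 0 < m) by (apply Cmod_gt_0, cexp_neq_0).
  exists (Rmin (1/2) (eps / (8 * m))). split.
  { apply Rmin_glb_lt; [lra|]. apply Rdiv_lt_0_compat; lra. }
  intros w W. apply Rmin_Rgt in W. destruct W as [W1 W2].
  replace w with (z + (w - z))%C at 1 by ring. rewrite cexp_plus.
  replace (cexp z * cexp (w - z) - cexp z - cexp z * (w - z))%C with
    (cexp z * (cexp (w - z) - 1 - (w - z)))%C by ring.
  rewrite Cmod_mult. fold m.
  assert (H := cexp_taylor (w - z) ltac:(lra)).
  set (r := Cmod (w - z)) in *. assert (0 <= r) by apply Cmod_ge_0.
  apply Rle_trans with (m * (8 * (r * r))); [apply Rmult_le_compat_l; lra|].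
  apply Rgt_lt in W2. apply Rlt_div_r in W2; [|lra]. nra.
Qed.

(** The argument on the right half plane, where the arctangent formula is valid and
    visibly continuous. *)
Definition carg (z : C) : R := atan (Im z / Re z).
Definition clog (z : C) : C := (ln (Cmod z), carg z).

Lemma carg_bound z : - (PI/2) < carg z < PI/2.
Proof. generalize (atan_bound (Im z / Re z)). unfold carg. lra. Qed.

Lemma Re_pos_neq_0 (z : C) : 0 < Re z -> z <> 0%C.
Proof. intros H E. rewrite E in H. simpl in H. lra. Qed.

Lemma carg_polar z : 0 < Re z -> Re z = Cmod z * cos (carg z) /\ Im z = Cmod z * sin (carg z).
Proof.
  intros H.
  assert (Hc : 0 < cos (carg z)) by (apply cos_gt_0; generalize (carg_bound z); lra).
  assert (T : sin (carg z) = cos (carg z) * (Im z / Re z)).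
  { generalize (tan_atan (Im z / Re z)). fold (carg z). unfold tan. intros E.
    rewrite <- E. field. lra. }
  assert (Q := sin2_cos2 (carg z)). unfold Rsqr in Q.
  set (c := cos (carg z)) in *. set (s := sin (carg z)) in *.
  assert (E : Cmod z = Re z / c).
  { assert (M := Cmod2_alt z).
    assert (E2 : (Cmod z)^2 = (Re z / c)^2).
    { rewrite M. replace (Im z) with (Re z * s / c) by (rewrite T; field; lra).
      replace (Re z ^ 2 + (Re z * s / c) ^ 2) with ((Re z / c)^2 * (s * s + c * c)) by (field; lra).
      rewrite Q. ring. }
    assert (0 < Re z / c) by (apply Rdiv_lt_0_compat; lra).
    assert (0 <= Cmod z) by apply Cmod_ge_0. nra. }
  rewrite E, T. split; field; lra.
Qed.

Lemma cexp_clog z : 0 < Re z -> cexp (clog z) = z.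
Proof.
  intros H. unfold cexp, clog; simpl.
  rewrite exp_ln by (apply Cmod_gt_0, Re_pos_neq_0, H).
  destruct (carg_polar z H) as [<- <-]. now destruct z.
Qed.

Lemma ball_of_Cmod (z w : C) (d : R) : Cmod (w - z) < d -> @ball C_UniformSpace z d w.
Proof. apply C_NormedModule_mixin_compat1. Qed.

Lemma continuous_eps (f : C -> R) (z : C) : continuous (T := C_UniformSpace) f z ->
  forall eps, 0 < eps -> exists d, 0 < d /\ forall w, Cmod (w - z) < d -> Rabs (f w - f z) < eps.
Proof.
  intros H eps He.
  apply filterlim_locally with (eps := mkposreal eps He) in H. destruct H as [d Hd].
  exists d; split; [apply cond_pos|]. intros w W. apply Hd. now apply ball_of_Cmod.
Qed.

Lemma Cmod_of_ball (z w : C) (d : posreal) : @ball C_UniformSpace z d w -> Cmod (w - z) < 2 * d.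
Proof.
  intros H. apply C_NormedModule_mixin_compat2 in H.
  eapply Rlt_le_trans; [exact H|]. apply Rmult_le_compat_r; [apply Rlt_le, cond_pos|].
  assert (S : sqrt 2 <= sqrt (2 * 2)) by (apply sqrt_le_1_alt; lra).
  rewrite sqrt_square in S; lra.
Qed.

(** The balls of the product topology on [C] are squares; up to a factor 2 they are the balls
    of the modulus, so functions that are 1-Lipschitz for the modulus are continuous. *)
Lemma continuous_of_le_Cmod (f : C -> R) (z : C) :
  (forall w, Rabs (f w - f z) <= Cmod (w - z)) -> continuous (T := C_UniformSpace) f z.
Proof.
  intros H. apply filterlim_locally. intros eps.
  exists (pos_div_2 eps). intros w W. apply Cmod_of_ball in W. simpl in W.
  eapply Rle_lt_trans; [apply H|]. simpl in *. lra.
Qed.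

Lemma continuous_Re (z : C) : continuous (T := C_UniformSpace) Re z.
Proof. apply continuous_of_le_Cmod. intros w. exact (re_le_Cmod (w - z)). Qed.

Lemma continuous_Im (z : C) : continuous (T := C_UniformSpace) Im z.
Proof. apply continuous_of_le_Cmod. intros w. exact (Im_le_Cmod (w - z)). Qed.

Lemma continuous_Cmod (z : C) : continuous (T := C_UniformSpace) Cmod z.
Proof.
  apply continuous_of_le_Cmod. intros w. apply Rabs_le. split.
  - generalize (Cmod_triangle_rev z (w - z)). replace (z + (w - z))%C with w by ring. lra.
  - generalize (Cmod_triangle z (w - z)). replace (z + (w - z))%C with w by ring. lra.
Qed.

Lemma continuous_ln_Cmod (z : C) : z <> 0%C ->
  continuous (T := C_UniformSpace) (fun w => ln (Cmod w)) z.
Proof.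
  intros H. apply (continuous_comp (U := C_UniformSpace) Cmod ln); [apply continuous_Cmod|].
  apply (ex_derive_continuous (V := R_NormedModule)). auto_derive. now apply Cmod_gt_0.
Qed.

Lemma continuous_carg (z : C) : 0 < Re z -> continuous (T := C_UniformSpace) carg z.
Proof.
  intros H. apply (continuous_comp (U := C_UniformSpace) (fun w => Im w / Re w) atan).
  - apply (continuous_mult (U := C_UniformSpace) (K := R_AbsRing)); [apply continuous_Im|].
    apply (continuous_comp (U := C_UniformSpace) Re Rinv); [apply continuous_Re|].
    apply continuous_Rinv. lra.
  - apply (ex_derive_continuous (V := R_NormedModule)). now auto_derive.
Qed.

Lemma eps_continuous_at_clog (z : C) : 0 < Re z -> eps_continuous_at clog z.
Proof.
  intros H eps He.
  destruct (continuous_eps _ _ (continuous_ln_Cmod z (Re_pos_neq_0 z H)) (eps / 2)) as [d [Hd D]];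
  [lra|].
  destruct (continuous_eps _ _ (continuous_carg z H) (eps / 2)) as [e [He' E]]; [lra|].
  exists (Rmin d e); split; [now apply Rmin_glb_lt|]. intros w W.
  apply Rmin_Rgt in W. destruct W as [W1 W2].
  eapply Rle_lt_trans; [apply Cmod_le_Re_Im|].
  specialize (D w W1). specialize (E w W2).
  apply Rlt_le_trans with (eps / 2 + eps / 2); [|lra].
  apply Rplus_lt_compat; [exact D | exact E].
Qed.

Lemma Re_pos_near (z w : C) (r : R) : Cmod (w - z) < Re z - r -> r < Re w.
Proof.
  intros H. assert (A := re_le_Cmod (w - z)).
  assert (Re (w - z) = Re w - Re z) by (destruct w, z; reflexivity).
  rewrite H0 in A. apply Rabs_le_between in A. lra.
Qed.

Lemma has_cderiv_clog (z : C) : 0 < Re z -> has_cderiv clog z (/ z).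
Proof.
  intros H. replace (/ z)%C with (1 / z)%C by (field; now apply Re_pos_neq_0).
  apply has_cderiv_implicit with (G := cexp) (F := fun w => w).
  - rewrite <- (cexp_clog z H) at 2. apply has_cderiv_cexp.
  - now apply Re_pos_neq_0.
  - apply has_cderiv_id.
  - now apply eps_continuous_at_clog.
  - exists (Re z); split; auto. intros w W. apply cexp_clog.
    apply Re_pos_near with z. lra.
Qed.

Definition cpow (a v : C) : C := cexp (a * clog v).

Lemma has_cderiv_cpow (a v : C) : 0 < Re v -> has_cderiv (cpow a) v (a * cpow a v / v).
Proof.
  intros H. replace (a * cpow a v / v)%C with (cexp (a * clog v) * (a * / v))%C
   by (unfold cpow; field; now apply Re_pos_neq_0).
  apply (has_cderiv_comp cexp (fun w => a * clog w)%C); [|apply has_cderiv_cexp].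
  apply (has_cderiv_comp (fun w => a * w)%C clog);
  [now apply has_cderiv_clog|apply has_cderiv_scal].
Qed.

(** * Lipschitz bound from the derivative *)

Definition half_plane (r : R) (v : C) : Prop := r < Re v.

Lemma Re_plus (z w : C) : Re (z + w) = Re z + Re w.
Proof. reflexivity. Qed.
Lemma Im_plus (z w : C) : Im (z + w) = Im z + Im w.
Proof. reflexivity. Qed.
Lemma Re_minus (z w : C) : Re (z - w) = Re z - Re w.
Proof. reflexivity. Qed.

(** The mean value inequality has no equality form for complex values, so the real mean value
    theorem is applied to the component of [f], along the segment from [v] to [w], in the
    direction of the total increment [d = f w - f v]. *)
Lemma cderiv_lipschitz (f f' : C -> C) (r M : R) :
  (forall v, half_plane r v -> has_cderiv f v (f' v)) ->
  (forall v, half_plane r v -> Cmod (f' v) <= M) ->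
  forall v w, half_plane r v -> half_plane r w -> Cmod (f w - f v) <= M * Cmod (w - v).
Proof.
  intros Hd HM v w Hv Hw.
  set (d := (f w - f v)%C). set (p := fun t : R => (v + t * (w - v))%C).
  set (phi := fun t : R => Re (Cconj d * f (p t))).
  assert (Hp : forall t, 0 <= t <= 1 -> half_plane r (p t)).
  { intros t Ht. unfold half_plane, p in *. rewrite Re_plus, re_scal_l, Re_minus.
    destruct (Rle_lt_dec (Re v) (Re w)); nra. }
  assert (Hphi : forall t, 0 <= t <= 1 -> is_derive phi t (Re (Cconj d * (f' (p t) * (w - v))))).
  { intros t Ht.
    assert (K : has_cderiv (fun x => Cconj d * f (v + x * (w - v)))%C (RtoC t) (Cconj d * (f' (p t) * (w - v)))).
    { apply (has_cderiv_comp (fun y => Cconj d * y)%C (fun x => f (v + x * (w - v)))%C);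
      [|apply has_cderiv_scal].
      apply (has_cderiv_comp f (fun x => v + x * (w - v))%C); [|now apply Hd, Hp].
      rewrite <- (Cplus_0_l (w - v)).
      apply (has_cderiv_plus (fun _ => v) (fun x => x * (0 + (w - v)))%C);
      [apply has_cderiv_const|].
      rewrite Cplus_0_l.
      intros eps He. destruct (has_cderiv_scal (w - v) (RtoC t) eps He) as [e [He' E]].
      exists e; split; auto. intros u U. rewrite (Cmult_comm u), (Cmult_comm (RtoC t)). auto. }
    split; [apply is_linear_scal_l|]. intros x Hx.
    assert (E : t = x) by exact (is_filter_lim_locally_unique (V := R_NormedModule) t x Hx).
    subst x. intros eps. destruct (K eps (cond_pos eps)) as [e [He E]].
    exists (mkposreal e He). intros s Hs.
    assert (Q : Cmod (RtoC s - RtoC t) = Rabs (s - t)) by (rewrite <- RtoC_minus; apply Cmod_R).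
    specialize (E s). rewrite Q in E. specialize (E Hs).
    change (Rabs (phi s - phi t - (s - t) * Re (Cconj d * (f' (p t) * (w - v)))) <= eps * Rabs (s - t)).
    eapply Rle_trans; [|exact E]. eapply Rle_trans; [|apply re_le_Cmod]. right. f_equal.
    rewrite !Re_minus. unfold phi, p. f_equal.
    rewrite <- RtoC_minus, (Cmult_comm _ (RtoC (s - t))). symmetry. apply re_scal_l. }
  destruct (MVT_gen phi 0 1 (fun t => Re (Cconj d * (f' (p t) * (w - v))))) as [c [Hc E]].
  - intros x Hx. apply Hphi. rewrite Rmin_left, Rmax_right in Hx by lra. lra.
  - intros x Hx. rewrite Rmin_left, Rmax_right in Hx by lra.
    apply continuity_pt_filterlim, (ex_derive_continuous (V := R_NormedModule)).
    eexists. apply Hphi. exact Hx.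
  - rewrite Rmin_left, Rmax_right in Hc by lra.
    assert (Ed : phi 1 - phi 0 = Cmod d * Cmod d).
    { unfold phi, p. rewrite <- Re_minus.
      replace (v + 1 * (w - v))%C with w by ring. replace (v + 0 * (w - v))%C with v by ring.
      replace (Cconj d * f w - Cconj d * f v)%C with (d * Cconj d)%C by (unfold d; ring).
      rewrite <- Cmod2_conj. simpl. ring. }
    assert (U : phi 1 - phi 0 <= Cmod d * (M * Cmod (w - v))).
    { rewrite E. replace (1 - 0) with 1 by ring. rewrite Rmult_1_r.
      eapply Rle_trans; [apply Rle_abs|]. eapply Rle_trans; [apply re_le_Cmod|].
      rewrite !Cmod_mult, Cmod_conj. apply Rmult_le_compat_l; [apply Cmod_ge_0|].
      apply Rmult_le_compat_r; [apply Cmod_ge_0|]. now apply HM, Hp. }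
    rewrite Ed in U. destruct (Cmod_ge_0 d) as [Hd0|Hd0].
    + now apply Rmult_le_reg_l with (Cmod d).
    + rewrite <- Hd0. apply Rmult_le_pos; [|apply Cmod_ge_0].
      eapply Rle_trans; [apply Cmod_ge_0|]. now apply (HM v).
Qed.

(** * Perturbations of the identity *)

Lemma seq_C_complete (u : nat -> C) (k B : R) : 0 <= k < 1 ->
  (forall n, Cmod (u (S n) - u n) <= B * k ^ n) ->
  exists l : C, forall eps, 0 < eps -> exists N, forall n, (N <= n)%nat -> Cmod (u n - l) < eps.
Proof.
  intros Hk Hu.
  assert (Key : forall p : C -> R, (forall z w, p (z - w)%C = p z - p w) -> (forall z, Rabs (p z) <= Cmod z) ->
    exists l : R, is_lim_seq (fun n => p (u n)) l).
  { intros p Hp Hpb.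
    assert (S1 : ex_series (fun n => p (u (S n)) - p (u n))).
    { apply (ex_series_le (K := R_AbsRing) (V := R_CompleteNormedModule)) with (fun n => B * k ^ n).
      - intros n. rewrite <- Hp. eapply Rle_trans; [apply Hpb|apply Hu].
      - apply (ex_series_scal (V := R_NormedModule) B). apply ex_series_geom. rewrite Rabs_right;
        lra. }
    destruct S1 as [l Hl]. exists (l + p (u 0%nat)).
    apply is_lim_seq_incr_1.
    apply is_lim_seq_ext with (fun n => sum_n (fun n => p (u (S n)) - p (u n)) n + p (u 0%nat)).
    - intros n. induction n.
      + rewrite sum_O. ring.
      + rewrite sum_Sn. unfold plus; simpl. lra.
    - apply is_lim_seq_plus'; [exact Hl|apply is_lim_seq_const]. }
  destruct (Key Re Re_minus re_le_Cmod) as [a Ha].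
  destruct (Key Im (fun z w => eq_refl) Im_le_Cmod) as [b Hb].
  exists (a, b). intros eps He.
  apply is_lim_seq_spec in Ha. apply is_lim_seq_spec in Hb.
  assert (He2 : 0 < eps / 2) by lra.
  destruct (Ha (mkposreal _ He2)) as [N1 H1]. destruct (Hb (mkposreal _ He2)) as [N2 H2].
  exists (max N1 N2). intros n Hn.
  eapply Rle_lt_trans; [apply Cmod_le_Re_Im|].
  apply Rlt_le_trans with (eps / 2 + eps / 2); [|lra].
  apply Rplus_lt_compat; [apply H1 | apply H2]; lia.
Qed.

(** The contraction principle on a closed ball: the orbit of the center is a Cauchy sequence
    that stays in the ball. *)
Lemma contraction_fixed_point (F : C -> C) (p : C) (rho k : R) : 0 <= k < 1 -> 0 <= rho ->
  (forall v, Cmod (v - p) <= rho -> Cmod (F v - p) <= rho) ->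
  (forall v w, Cmod (v - p) <= rho -> Cmod (w - p) <= rho -> Cmod (F w - F v) <= k * Cmod (w - v)) ->
  exists v, Cmod (v - p) <= rho /\ F v = v.
Proof.
  intros Hk Hrho Hself Hlip.
  set (u := fun n => Nat.iter n F p).
  assert (Hu : forall n, Cmod (u n - p) <= rho).
  { induction n.
    - simpl. replace (p - p)%C with (RtoC 0) by ring. now rewrite Cmod_0.
    - now apply Hself. }
  destruct (seq_C_complete u k (Cmod (F p - p)) Hk) as [l Hl].
  { induction n.
    - simpl. lra.
    - change (u (S (S n))) with (F (u (S n))). change (u (S n)) with (F (u n)) at 2.
      eapply Rle_trans; [apply Hlip; apply Hu|]. simpl.
      apply (Rmult_le_compat_l k) in IHn; [|lra]. change (F (u n)) with (u (S n)). lra. }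
  assert (Hlp : Cmod (l - p) <= rho).
  { apply le_epsilon. intros eps He. destruct (Hl eps He) as [N HN]. specialize (HN N (le_n N)).
    specialize (Hu N).
    replace (l - p)%C with (- (u N - l) + (u N - p))%C by ring.
    eapply Rle_trans; [apply Cmod_triangle|]. rewrite Cmod_opp. lra. }
  exists l; split; auto.
  assert (Z : Cmod (F l - l) <= 0).
  { apply le_epsilon. intros eps He. destruct (Hl (eps / 2)) as [N HN]; [lra|].
    assert (H1 := HN N (le_n N)). assert (H2 := HN (S N) (le_S _ _ (le_n N))).
    assert (H3 := Hlip l (u N) Hlp (Hu N)).
    change (F (u N)) with (u (S N)) in H3.
    replace (F l - l)%C with (- (u (S N) - F l) + (u (S N) - l))%C by ring.
    eapply Rle_trans; [apply Cmod_triangle|]. rewrite Cmod_opp.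
    assert (k * Cmod (u N - l) <= 1 * Cmod (u N - l)).
    { apply Rmult_le_compat_r; [apply Cmod_ge_0|lra]. }
    lra. }
  assert (E : (F l - l = 0)%C) by (apply Cmod_eq_0; generalize (Cmod_ge_0 (F l - l)); lra).
  now apply Ceq_minus.
Qed.

Definition contracting_on (r k : R) (s : C -> C) : Prop :=
  forall v w, half_plane r v -> half_plane r w -> Cmod (s w - s v) <= k * Cmod (w - v).

(** The equation for [w] is the fixed point equation [w = v + T - (s w - s v)]. Its right-hand
    side preserves the closed ball of center [v + T] and radius [|T|/2], since
    [(|T| + |T|/2) / 3 = |T|/2]. The hypothesis on [T] puts this ball to the right of [v],
    hence inside the half plane: that is why the range of [id + s] is stable under
    translation by positive reals although nothing is known of its shape. *)
Lemma perturbed_identity_solvable (s : C -> C) (r : R) (v T : C) :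
  contracting_on r (1/3) s -> half_plane r v -> Cmod T <= 2 * Re T ->
  exists w, half_plane r w /\ (w + s w = v + s v + T)%C.
Proof.
  intros Hs Hv HT.
  assert (Hball : forall w, Cmod (w - (v + T)) <= Cmod T / 2 -> half_plane r w).
  { intros w Hw. unfold half_plane in *.
    assert (A := re_le_Cmod (w - (v + T))). rewrite Re_minus, Re_plus in A.
    apply Rabs_le_between in A. lra. }
  destruct (contraction_fixed_point (fun w => v + T - (s w - s v))%C (v + T) (Cmod T / 2) (1/3))
    as [w [Hw E]].
  - lra.
  - generalize (Cmod_ge_0 T). lra.
  - intros w Hw.
    replace (v + T - (s w - s v) - (v + T))%C with (- (s w - s v))%C by ring. rewrite Cmod_opp.
    eapply Rle_trans; [apply Hs; auto|].
    replace (w - v)%C with ((w - (v + T)) + T)%C by ring.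
    generalize (Cmod_triangle (w - (v + T)) T). lra.
  - intros w w' Hw Hw'.
    replace (v + T - (s w' - s v) - (v + T - (s w - s v)))%C with (- (s w' - s w))%C by ring.
    rewrite Cmod_opp. apply Hs; auto.
  - exists w; split; auto. rewrite <- E at 1. ring.
Qed.

Lemma perturbed_identity_expanding (s : C -> C) (r : R) (v w : C) :
  contracting_on r (1/3) s -> half_plane r v -> half_plane r w ->
  2 / 3 * Cmod (w - v) <= Cmod (w + s w - (v + s v)) <= 4 / 3 * Cmod (w - v).
Proof.
  intros Hs Hv Hw. specialize (Hs v w Hv Hw).
  replace (w + s w - (v + s v))%C with ((w - v) + (s w - s v))%C by ring.
  generalize (Cmod_triangle_rev (w - v) (s w - s v)) (Cmod_triangle (w - v) (s w - s v)). lra.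
Qed.

(** * The linearizing map in the half plane *)

(** Any small positive constant would do: it has to make [perturbation] below a
    1/3-contraction, and to keep the limiting arguments in the interval [[-1/2, 1/2]]
    on which [exp_sin] is increasing. *)
Definition amplitude : R := 1 / 100.
Definition perturbation (v : C) : C := (amplitude * cpow (1 + Ci) v)%C.
Definition perturbation' (v : C) : C := (amplitude * ((1 + Ci) * cpow (1 + Ci) v / v))%C.

Lemma cpow_1Ci (v : C) : cpow (1 + Ci) v =
  cexp (ln (Cmod v) - carg v, ln (Cmod v) + carg v).
Proof. unfold cpow. f_equal. unfold clog, Cmult, Cplus, Ci, RtoC; simpl. f_equal; ring. Qed.

(** [PI/2 < 2] and [e <= 3]. *)
Lemma exp_le_9 y : - (PI/2) < y < PI/2 -> exp y <= 9.
Proof.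
  intros H. assert (P := PI_4). apply Rle_trans with (exp (1 + 1)).
  - left. apply exp_increasing. lra.
  - rewrite exp_plus. assert (E := exp_le_3). assert (Q := exp_pos 1). nra.
Qed.

(** [|v^(1+i)| = |v| e^(- arg v)]: the imaginary exponent turns the bounded argument into a
    bounded factor, so that the perturbation stays small compared with [v]. *)
Lemma Cmod_cpow_1Ci (v : C) : v <> 0%C -> Cmod (cpow (1 + Ci) v) <= 9 * Cmod v.
Proof.
  intros H. apply Cmod_gt_0 in H. rewrite cpow_1Ci, Cmod_cexp. simpl.
  unfold Rminus. rewrite exp_plus, exp_ln by auto. rewrite Rmult_comm.
  apply Rmult_le_compat_r; [lra|]. apply exp_le_9. generalize (carg_bound v). lra.
Qed.

Lemma has_cderiv_perturbation (v : C) : 0 < Re v -> has_cderiv perturbation v (perturbation' v).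
Proof.
  intros H. apply (has_cderiv_comp (fun w => amplitude * w)%C (cpow (1 + Ci))).
  - now apply has_cderiv_cpow.
  - apply has_cderiv_scal.
Qed.

Lemma Cmod_perturbation' (v : C) : 0 < Re v -> Cmod (perturbation' v) <= 1/3.
Proof.
  intros H. assert (Hv := Re_pos_neq_0 v H). unfold perturbation'.
  rewrite Cmod_mult, Cmod_div, Cmod_mult, Cmod_R by auto.
  assert (H1 := Cmod_cpow_1Ci v Hv). assert (H2 := Cmod_triangle 1 Ci).
  rewrite Cmod_1, Cmod_Ci in H2. apply Cmod_gt_0 in Hv.
  rewrite Rabs_right by (unfold amplitude; lra).
  assert (Cmod (1 + Ci) * Cmod (cpow (1 + Ci) v) / Cmod v <= 18).
  { apply Rle_div_l; auto. replace (18 * Cmod v) with (2 * (9 * Cmod v)) by ring.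
    apply Rmult_le_compat; auto using Cmod_ge_0. }
  unfold amplitude. lra.
Qed.

Lemma perturbation_contracting : contracting_on (1/2) (1/3) perturbation.
Proof.
  intros v w. apply cderiv_lipschitz with (f' := perturbation'); intros u Hu.
  - apply has_cderiv_perturbation. unfold half_plane in Hu. lra.
  - apply Cmod_perturbation'. unfold half_plane in Hu. lra.
Qed.

Definition koenigs_Omega (v : C) : C := (v + perturbation v)%C.

(** The image of the unit disk under [z |-> 1 / (1 - z)]. *)
Notation Omega := (half_plane (1/2)).

Lemma koenigs_Omega_solvable (v T : C) : Omega v -> Cmod T <= 2 * Re T ->
  exists w, Omega w /\ koenigs_Omega w = (koenigs_Omega v + T)%C.
Proof. apply perturbed_identity_solvable, perturbation_contracting. Qed.

Lemma koenigs_Omega_expanding v w : Omega v -> Omega w ->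
  2 / 3 * Cmod (w - v) <= Cmod (koenigs_Omega w - koenigs_Omega v) <= 4 / 3 * Cmod (w - v).
Proof. apply perturbed_identity_expanding, perturbation_contracting. Qed.

Lemma koenigs_Omega_inj v w : Omega v -> Omega w -> koenigs_Omega v = koenigs_Omega w -> v = w.
Proof.
  intros Hv Hw E. assert (A := koenigs_Omega_expanding v w Hv Hw). rewrite E in A.
  replace (koenigs_Omega w - koenigs_Omega w)%C with (RtoC 0) in A by ring. rewrite Cmod_0 in A.
  assert (Z : (w - v = 0)%C) by (apply Cmod_eq_0; generalize (Cmod_ge_0 (w - v)); lra).
  symmetry. now apply Ceq_minus.
Qed.

Lemma has_cderiv_koenigs_Omega v : Omega v -> has_cderiv koenigs_Omega v (1 + perturbation' v).
Proof.
  intros H. apply (has_cderiv_plus (fun w => w) perturbation); [apply has_cderiv_id|].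
  apply has_cderiv_perturbation. unfold half_plane in H. lra.
Qed.

Lemma koenigs_Omega_deriv_neq_0 (v : C) : Omega v -> (1 + perturbation' v)%C <> 0%C.
Proof.
  intros H. apply Cmod_gt_0. generalize (Cmod_triangle_rev 1 (perturbation' v)).
  rewrite Cmod_1. assert (X : 0 < Re v) by (unfold half_plane in H; lra).
  generalize (Cmod_perturbation' v X). lra.
Qed.

(** * The flow in the half plane *)

Definition flow (t : R) (v : C) : C :=
  epsilon (inhabits (RtoC 0)) (fun w => Omega w /\ koenigs_Omega w = (koenigs_Omega v + t)%C).

Lemma flow_spec t v : 0 <= t -> Omega v ->
  Omega (flow t v) /\ koenigs_Omega (flow t v) = (koenigs_Omega v + t)%C.
Proof.
  intros Ht Hv. unfold flow. apply epsilon_spec. apply koenigs_Omega_solvable; auto.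
  rewrite Cmod_R, re_RtoC, Rabs_right; lra.
Qed.

Lemma flow_Omega t v : 0 <= t -> Omega v -> Omega (flow t v).
Proof. intros; now apply flow_spec. Qed.

Lemma koenigs_Omega_flow t v : 0 <= t -> Omega v ->
  koenigs_Omega (flow t v) = (koenigs_Omega v + t)%C.
Proof. intros; now apply flow_spec. Qed.

Lemma flow_lipschitz t t' v w : 0 <= t -> 0 <= t' -> Omega v -> Omega w ->
  Cmod (flow t' w - flow t v) <= 3 / 2 * (Cmod (koenigs_Omega w - koenigs_Omega v) + Rabs (t' - t)).
Proof.
  intros Ht Ht' Hv Hw.
  assert (A := koenigs_Omega_expanding _ _ (flow_Omega t v Ht Hv) (flow_Omega t' w Ht' Hw)).
  rewrite !koenigs_Omega_flow in A by auto.
  replace (koenigs_Omega w + t' - (koenigs_Omega v + t))%C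
    with ((koenigs_Omega w - koenigs_Omega v) + (t' - t)%R)%C in A
    by (rewrite RtoC_minus; ring).
  generalize (Cmod_triangle (koenigs_Omega w - koenigs_Omega v) (t' - t)%R). rewrite Cmod_R. lra.
Qed.

Lemma flow_lipschitz_time t t' v : 0 <= t -> 0 <= t' -> Omega v ->
  Cmod (flow t' v - flow t v) <= 3 / 2 * Rabs (t' - t).
Proof.
  intros Ht Ht' Hv. assert (A := flow_lipschitz t t' v v Ht Ht' Hv Hv).
  replace (koenigs_Omega v - koenigs_Omega v)%C with (RtoC 0) in A by ring. rewrite Cmod_0 in A.
  lra.
Qed.

(** Along a trajectory the linearizing map, whose Lipschitz constant is [4/3], moves by [t]. *)
Lemma flow_far t v : 0 <= t -> Omega v -> 3 / 4 * t - Cmod v <= Cmod (flow t v).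
Proof.
  intros Ht Hv. assert (A := koenigs_Omega_expanding _ _ Hv (flow_Omega t v Ht Hv)).
  rewrite koenigs_Omega_flow in A by auto.
  replace (koenigs_Omega v + t - koenigs_Omega v)%C with (RtoC t) in A by ring.
  rewrite Cmod_R, Rabs_right in A by lra.
  generalize (Cmod_triangle (flow t v) (- v)). rewrite Cmod_opp.
  replace (flow t v + - v)%C with (flow t v - v)%C by ring. lra.
Qed.

Lemma flow_0 v : Omega v -> flow 0 v = v.
Proof.
  intros H. apply koenigs_Omega_inj; auto using flow_Omega, Rle_refl.
  rewrite koenigs_Omega_flow by (auto; lra). ring.
Qed.

Lemma flow_add s t v : 0 <= s -> 0 <= t -> Omega v -> flow (s + t) v = flow s (flow t v).
Proof.
  intros Hs Ht Hv. apply koenigs_Omega_inj; auto using flow_Omega, Rplus_le_le_0_compat.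
  rewrite !koenigs_Omega_flow by (auto using flow_Omega, Rplus_le_le_0_compat). rewrite RtoC_plus.
  ring.
Qed.

Lemma Omega_near (v : C) : Omega v -> exists d, 0 < d /\ forall w, Cmod (w - v) < d -> Omega w.
Proof.
  intros H. exists (Re v - 1/2). unfold half_plane in *. split; [lra|].
  intros w W. now apply Re_pos_near with v.
Qed.

(** Implicit differentiation of [koenigs_Omega (flow t w) = koenigs_Omega w + t]; the continuity
    of [flow t] comes from the Lipschitz bound on the inverse of [koenigs_Omega]. *)
Lemma has_cderiv_flow t v : 0 <= t -> Omega v ->
  has_cderiv (flow t) v ((1 + perturbation' v) / (1 + perturbation' (flow t v))).
Proof.
  intros Ht Hv. destruct (Omega_near v Hv) as [d [Hd D]].
  apply has_cderiv_implicit with (G := koenigs_Omega) (F := fun w => (koenigs_Omega w + t)%C).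
  - now apply has_cderiv_koenigs_Omega, flow_Omega.
  - now apply koenigs_Omega_deriv_neq_0, flow_Omega.
  - rewrite <- (Cplus_0_r (1 + perturbation' v)).
    apply has_cderiv_plus; [now apply has_cderiv_koenigs_Omega|apply has_cderiv_const].
  - intros eps He. exists (Rmin d (eps / 2)). split; [apply Rmin_glb_lt; lra|].
    intros w W. apply Rmin_Rgt in W. destruct W as [W1 W2]. specialize (D w W1).
    assert (A := flow_lipschitz t t v w Ht Ht Hv D).
    assert (B := koenigs_Omega_expanding v w Hv D).
    rewrite Rminus_diag, Rabs_R0 in A. lra.
  - exists d; split; auto. intros w W. apply koenigs_Omega_flow; auto.
Qed.

(** * Transport to the disk *)

Definition to_Omega (z : C) : C := (/ (1 - z))%C.

Lemma disk_neq_1 (z : C) : unit_disk z -> (1 - z)%C <> 0%C.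
Proof.
  intros H. apply Cmod_gt_0. generalize (Cmod_triangle_rev 1 (- z)).
  rewrite Cmod_opp, Cmod_1. unfold unit_disk in H. unfold Cminus. lra.
Qed.

Lemma to_Omega_disk z : unit_disk z -> Omega (to_Omega z).
Proof.
  intros H. assert (N := disk_neq_1 z H). unfold unit_disk in H. unfold half_plane, to_Omega.
  assert (M := Cmod2_alt z). assert (P := Cmod2_alt (1 - z)). apply Cmod_gt_0 in N.
  assert (G := Cmod_ge_0 z).
  destruct z as [x y]. unfold Cinv, Cminus, Cplus, Copp, RtoC, Re, Im in *. simpl fst in *.
  simpl snd in *.
  assert (D : 0 < (1 + - x) ^ 2 + (0 + - y) ^ 2) by (rewrite <- P; nra).
  apply (proj1 (Rlt_div_r _ _ _ D)). nra.
Qed.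

Lemma Omega_neq_0 (v : C) : Omega v -> v <> 0%C.
Proof. intros H. apply Re_pos_neq_0. unfold half_plane in H. lra. Qed.

Lemma disk_of_Omega (v : C) : Omega v -> unit_disk (1 - / v).
Proof.
  intros H. assert (N := Omega_neq_0 v H). unfold unit_disk.
  replace (1 - / v)%C with ((v - 1) / v)%C by (field; auto).
  rewrite Cmod_div by auto. apply Cmod_gt_0 in N. apply Rlt_div_l; auto.
  assert (M := Cmod2_alt v). assert (P := Cmod2_alt (v - 1)).
  assert (G := Cmod_ge_0 (v - 1)).
  unfold half_plane in H.
  replace (Re (v - 1)) with (Re v - 1) in P by (destruct v; reflexivity).
  replace (Im (v - 1)) with (Im v) in P by (destruct v; simpl; ring).
  nra.
Qed.

Lemma to_Omega_inv (v : C) : v <> 0%C -> to_Omega (1 - / v) = v.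
Proof.
  intros H. unfold to_Omega. replace (1 - (1 - / v))%C with (/ v)%C by ring. field; auto.
Qed.

Lemma inv_to_Omega z : unit_disk z -> (1 - / to_Omega z)%C = z.
Proof.
  intros H. assert (N := disk_neq_1 z H). unfold to_Omega. field. auto. Qed.

Lemma has_cderiv_one_minus f z l : has_cderiv f z l ->
  has_cderiv (fun w => 1 - f w)%C z (- (1) * l).
Proof.
  intros H. unfold Cminus.
  rewrite <- (Cplus_0_l (- (1) * l)). apply (has_cderiv_plus (fun _ => RtoC 1) (fun w => - f w)%C);
  [apply has_cderiv_const|].
  apply (has_cderiv_comp (fun w => - w)%C f); auto.
  intros eps He. destruct (has_cderiv_scal (- (1)) (f z) eps He) as [d [Hd D]].
  exists d; split; auto. intros w W. specialize (D w W).
  replace (- w - - f z)%C with (- (1) * w - - (1) * f z)%C by ring. auto.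
Qed.

Lemma ex_cderiv_to_Omega z : unit_disk z -> exists l, has_cderiv to_Omega z l.
Proof.
  intros H. eexists. apply (has_cderiv_comp Cinv (fun z => 1 - z)%C).
  - apply has_cderiv_one_minus, has_cderiv_id.
  - apply has_cderiv_inv. now apply disk_neq_1.
Qed.

Definition disk_semigroup (t : R) (z : C) : C := (1 - / flow t (to_Omega z))%C.
(** The factor [i] turns the translation by [t] into the translation by [i t]. *)
Definition koenigs (z : C) : C := (Ci * koenigs_Omega (to_Omega z))%C.

Lemma to_Omega_disk_semigroup t z : 0 <= t -> unit_disk z ->
  to_Omega (disk_semigroup t z) = flow t (to_Omega z).
Proof. intros. apply to_Omega_inv. now apply Omega_neq_0, flow_Omega, to_Omega_disk. Qed.

Lemma disk_semigroup_disk t z : 0 <= t -> unit_disk z -> unit_disk (disk_semigroup t z).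
Proof. intros. now apply disk_of_Omega, flow_Omega, to_Omega_disk. Qed.

Lemma Omega_Cmod (v : C) : Omega v -> 1 / 2 < Cmod v.
Proof. intros H. generalize (re_le_Cmod v) (Rle_abs (Re v)). unfold half_plane in H. lra. Qed.

(** The inverse coordinate change [v |-> 1 - 1/v] is 4-Lipschitz on [Omega], where [|v| > 1/2],
    and the flow is 3/2-Lipschitz in time. The bound is uniform over the whole disk. *)
Lemma disk_semigroup_lipschitz t t' z : 0 <= t -> 0 <= t' -> unit_disk z ->
  Cmod (disk_semigroup t' z - disk_semigroup t z) <= 6 * Rabs (t' - t).
Proof.
  intros Ht Ht' Hz. apply to_Omega_disk in Hz. unfold disk_semigroup.
  set (v := to_Omega z) in *.
  assert (H1 := flow_Omega t v Ht Hz). assert (H2 := flow_Omega t' v Ht' Hz).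
  assert (N1 := Omega_neq_0 _ H1). assert (N2 := Omega_neq_0 _ H2).
  replace (1 - / flow t' v - (1 - / flow t v))%C
    with ((flow t' v - flow t v) / (flow t' v * flow t v))%C
    by (field; auto).
  rewrite Cmod_div, Cmod_mult by (now apply Cmult_neq_0).
  apply Omega_Cmod in H1. apply Omega_Cmod in H2.
  assert (L := flow_lipschitz_time t t' v Ht Ht' Hz).
  assert (Q : 1 / 4 <= Cmod (flow t' v) * Cmod (flow t v)) by nra.
  apply Rle_div_l; [lra|]. generalize (Rabs_pos (t' - t)). nra.
Qed.

Lemma disk_semigroup_is_semigroup : semigroup_in_disk disk_semigroup.
Proof.
  constructor.
  - intros t Ht z Hz. now apply disk_semigroup_disk.
  - intros t Ht z Hz. destruct (ex_cderiv_to_Omega z Hz) as [l Hl].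
    eapply has_cderiv_ex_derive. apply has_cderiv_one_minus.
    apply (has_cderiv_comp Cinv (fun w => flow t (to_Omega w))).
    + apply (has_cderiv_comp (flow t) to_Omega); [exact Hl|].
      now apply has_cderiv_flow, to_Omega_disk.
    + now apply has_cderiv_inv, Omega_neq_0, flow_Omega, to_Omega_disk.
  - intros z Hz. unfold disk_semigroup. rewrite flow_0 by (now apply to_Omega_disk).
    now apply inv_to_Omega.
  - intros s t Hs Ht z Hz. unfold disk_semigroup at 1 2. rewrite to_Omega_disk_semigroup by auto.
    now rewrite flow_add by (auto using to_Omega_disk).
  - intros t0 Ht0 K _ HK eps.
    assert (He : 0 < eps / 6) by (generalize (cond_pos eps); lra).
    exists (mkposreal _ He). intros t Ht Htt z Hz. simpl in Htt.
    generalize (disk_semigroup_lipschitz t0 t z Ht0 Ht (HK z Hz)). lra.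
Qed.

Lemma koenigs_translate z z' t :
  koenigs_Omega (to_Omega z') = (koenigs_Omega (to_Omega z) + t)%C ->
  koenigs z' = (koenigs z + Ci * t)%C.
Proof. intros E. unfold koenigs. rewrite E. ring. Qed.

Lemma koenigs_disk_semigroup t z : 0 <= t -> unit_disk z ->
  koenigs (disk_semigroup t z) = (koenigs z + Ci * t)%C.
Proof.
  intros Ht Hz. apply koenigs_translate. rewrite to_Omega_disk_semigroup by auto.
  now apply koenigs_Omega_flow, to_Omega_disk.
Qed.

Lemma Ci_sqr : (Ci * Ci = - (1))%C.
Proof. unfold Ci, Cmult, Copp, RtoC; simpl; f_equal; ring. Qed.

(** The only point that goes beyond the properties of the flow is that the vertical
    translates of the range exhaust the plane. To reach [w], solvability is
    applied at the base point [1] with [T = a + t0], where [a] leads from the value at [1] to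
    the target [- i w] and [t0 = 3 |a|] is large enough for [|T| <= 2 Re T]. *)
Lemma disk_semigroup_parabolic : parabolic_zero_hyperbolic_step disk_semigroup.
Proof.
  split; [apply disk_semigroup_is_semigroup|]. exists koenigs. repeat split.
  - intros z Hz. destruct (ex_cderiv_to_Omega z Hz) as [l Hl].
    eapply has_cderiv_ex_derive.
    apply (has_cderiv_comp (fun w => Ci * w)%C (fun w => koenigs_Omega (to_Omega w))).
    + apply (has_cderiv_comp koenigs_Omega to_Omega); [exact Hl|].
      now apply has_cderiv_koenigs_Omega, to_Omega_disk.
    + apply has_cderiv_scal.
  - intros z w Hz Hw E. rewrite <- (inv_to_Omega z Hz), <- (inv_to_Omega w Hw).
    enough (Q : to_Omega z = to_Omega w) by now rewrite Q.
    apply koenigs_Omega_inj; auto using to_Omega_disk.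
    replace (koenigs_Omega (to_Omega z)) with (- (Ci * (koenigs z)))%C by (unfold koenigs;
    rewrite Cmult_assoc, Ci_sqr; ring).
    rewrite E. unfold koenigs; rewrite Cmult_assoc, Ci_sqr; ring.
  - intros t Ht z Hz. exists (disk_semigroup t z). split;
    [now apply disk_semigroup_disk| now apply koenigs_disk_semigroup].
  - intros t Ht z Hz. now apply koenigs_disk_semigroup.
  - intros w. set (a := (- Ci * w - koenigs_Omega 1)%C). exists (3 * Cmod a). split.
    + generalize (Cmod_ge_0 a). lra.
    + destruct (koenigs_Omega_solvable 1 (a + (3 * Cmod a)%R)) as [v [Hv E]].
      * unfold half_plane. simpl. lra.
      * eapply Rle_trans; [apply Cmod_triangle|]. rewrite Cmod_R, Re_plus, re_RtoC.
        assert (G := Cmod_ge_0 a). rewrite Rabs_right by lra.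
        assert (R := re_le_Cmod a). apply Rabs_le_between in R. lra.
      * exists (1 - / v)%C. split; [now apply disk_of_Omega|].
        unfold koenigs. rewrite to_Omega_inv, E by now apply Omega_neq_0.
        generalize (RtoC (3 * Cmod a)). intros r. unfold a.
        transitivity (- (Ci * Ci) * w + Ci * r)%C; [ring|]. rewrite Ci_sqr. ring.
Qed.

Lemma disk_semigroup_denjoy_wolff : denjoy_wolff_point disk_semigroup 1.
Proof.
  split; [rewrite Cmod_1; lra|]. intros z Hz. apply to_Omega_disk in Hz.
  apply (filterlim_locally (U := C_UniformSpace)). intros eps. assert (He := cond_pos eps).
  exists (Rmax 0 (4 / 3 * (Cmod (to_Omega z) + / eps))). intros t Ht.
  assert (Ht0 : 0 <= t) by (generalize (Rmax_l 0 (4 / 3 * (Cmod (to_Omega z) + / eps))); lra).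
  assert (Ht1 : 4 / 3 * (Cmod (to_Omega z) + / eps) < t).
  { eapply Rle_lt_trans; [apply Rmax_r|exact Ht]. }
  apply ball_of_Cmod. unfold disk_semigroup.
  assert (F := flow_far t _ Ht0 Hz). assert (N := Omega_neq_0 _ (flow_Omega t _ Ht0 Hz)).
  replace (1 - / flow t (to_Omega z) - 1)%C with (- / flow t (to_Omega z))%C by ring.
  rewrite Cmod_opp, Cmod_inv by auto.
  rewrite <- (Rinv_inv eps). apply Rinv_lt_contravar; [|lra].
  apply Rmult_lt_0_compat; [now apply Rinv_0_lt_compat|]. now apply Cmod_gt_0.
Qed.

(** * Cluster sets driven by a rotating phase *)

Lemma cluster_set_ext (f g : R -> R) (x : R) : (forall t, 0 <= t -> f t = g t) ->
  cluster_set_at_infty f x -> cluster_set_at_infty g x.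
Proof.
  intros E H eps T. destruct (H eps (Rmax 0 T)) as [t [Ht Hx]].
  exists t. assert (0 <= t) by (eapply Rle_trans; [apply Rmax_l|exact Ht]).
  rewrite <- E by auto. split; auto. eapply Rle_trans; [apply Rmax_r|exact Ht].
Qed.

Lemma cluster_set_opp (f : R -> R) (x : R) :
  cluster_set_at_infty f x -> cluster_set_at_infty (fun t => - f t) (- x).
Proof.
  intros H eps T. destruct (H eps T) as [t [Ht Hx]]. exists t; split; auto.
  replace (- f t - - x) with (- (f t - x)) by ring. now rewrite Rabs_Ropp.
Qed.

Definition exp_sin (y : R) : R := exp y * sin y.

Lemma sin_half_lower b : 1/2 <= b <= PI/2 -> 1/4 <= sin b.
Proof.
  intros H. assert (S := sin_taylor (1/2)). rewrite (Rabs_right (1/2)) in S by lra.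
  specialize (S ltac:(lra)). apply Rabs_le_between in S.
  assert (sin (1/2) <= sin b) by (apply sin_incr_1; lra). lra.
Qed.

(** The derivative is [e^u (sin u + cos u)]; on [[-1/2, 1/2]] the first factor is at least
    [1/2] and the second at least [1/8]. *)
Lemma exp_sin_expanding y y' : -1/2 <= y <= y' -> y' <= 1/2 ->
  (y' - y) / 16 <= exp_sin y' - exp_sin y.
Proof.
  intros H H'.
  destruct (MVT_gen exp_sin y y' (fun u => exp u * (sin u + cos u))) as [u [Hu E]].
  - intros x _. unfold exp_sin. auto_derive; auto. ring.
  - intros x _. apply continuity_pt_filterlim, (ex_derive_continuous (V := R_NormedModule)).
    unfold exp_sin. auto_derive; auto.
  - rewrite Rmin_left, Rmax_right in Hu by lra. rewrite E.
    assert (1/2 <= exp u) by (generalize (exp_ineq1_le u); lra).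
    assert (C := cos_taylor u). assert (S := sin_taylor u).
    assert (Hu2 : Rabs u <= 1/2) by (apply Rabs_le; lra). specialize (S ltac:(lra)).
    apply Rabs_le_between in S.
    assert (u * u <= 1/4) by nra.
    assert (1/8 <= sin u + cos u) by lra.
    assert (1/16 <= exp u * (sin u + cos u)) by nra.
    nra.
Qed.

Lemma exp_sin_le_inv y z d : Rabs y <= 1/2 -> Rabs z <= 1/2 ->
  exp_sin y <= exp_sin z + d -> 0 <= d -> y <= z + 16 * d.
Proof.
  intros Hy Hz H Hd. apply Rabs_le_between in Hy; apply Rabs_le_between in Hz.
  destruct (Rle_lt_dec y z); [lra|].
  assert (E := exp_sin_expanding z y). lra.
Qed.

Lemma exp_sin_surj q : Rabs q < 1/32 -> exists y, Rabs y <= 1/2 /\ exp_sin y = q.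
Proof.
  intros Hq. apply Rabs_lt_between in Hq.
  assert (Z : exp_sin 0 = 0) by (unfold exp_sin; rewrite sin_0; ring).
  assert (P := exp_sin_expanding 0 (1/2)). assert (Q := exp_sin_expanding (-1/2) 0).
  destruct (IVT_gen exp_sin (-1/2) (1/2) q) as [y [Hy E]].
  - intros x. apply continuity_pt_filterlim, (ex_derive_continuous (V := R_NormedModule)).
    unfold exp_sin. auto_derive; auto.
  - rewrite Rmin_left, Rmax_right by lra. lra.
  - rewrite Rmin_left, Rmax_right in Hy by lra. exists y; split; auto. apply Rabs_le. lra.
Qed.

(** The phase makes [c * sin (theta t)] sweep [[-c, c]] again and again, so the cluster set of
    [exp_sin (y t)] is [[-c, c]]; the expansion of [exp_sin] on [[-1/2, 1/2]] carries this
    back to [y]. *)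
Lemma cluster_set_interval (y theta : R -> R) (c a b : R) :
  0 < c ->
  (forall eps, 0 < eps -> exists T, forall t, T <= t ->
    Rabs (exp_sin (y t) + c * sin (theta t)) < eps) ->
  (exists T, forall t, T <= t -> Rabs (y t) <= 1/2) ->
  (forall q T, -1 <= q <= 1 -> exists t, T <= t /\ sin (theta t) = q) ->
  Rabs a <= 1/2 -> Rabs b <= 1/2 -> exp_sin a = - c -> exp_sin b = c ->
  forall x, cluster_set_at_infty y x <-> a <= x <= b.
Proof.
  intros Hc Hlim [T0 HT0] Hsin Ha Hb Ea Eb x. split.
  - intros H.
    assert (K : forall eps, 0 < eps -> a - 17 * eps <= x <= b + 17 * eps).
    { intros eps He. destruct (Hlim eps He) as [T1 HT1].
      destruct (H (mkposreal eps He) (Rmax T0 T1)) as [t [Ht Hx]].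
      assert (Hy := HT0 t (Rle_trans _ _ _ (Rmax_l _ _) Ht)).
      assert (HF := HT1 t (Rle_trans _ _ _ (Rmax_r _ _) Ht)).
      apply Rabs_lt_between in HF. simpl in Hx. apply Rabs_lt_between in Hx.
      assert (S := SIN_bound (theta t)).
      assert (c * sin (theta t) <= c * 1) by (apply Rmult_le_compat_l; lra).
      assert (c * -1 <= c * sin (theta t)) by (apply Rmult_le_compat_l; lra).
      assert (U := exp_sin_le_inv (y t) b eps Hy Hb ltac:(lra) ltac:(lra)).
      assert (L := exp_sin_le_inv a (y t) eps Ha Hy ltac:(lra) ltac:(lra)).
      lra. }
    split; apply le_epsilon; intros eps He; specialize (K (eps / 17) ltac:(lra)); lra.
  - intros Hx eps T. apply Rabs_le_between in Ha as Ha'. apply Rabs_le_between in Hb as Hb'.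
    assert (Hx2 : Rabs x <= 1/2) by (apply Rabs_le; lra).
    assert (Hq : - c <= exp_sin x <= c).
    { assert (A := exp_sin_expanding a x). assert (B := exp_sin_expanding x b). lra. }
    assert (He := cond_pos eps).
    destruct (Hlim (eps / 32) ltac:(lra)) as [T1 HT1].
    destruct (Hsin (- (exp_sin x / c)) (Rmax T (Rmax T0 T1))) as [t [Ht E]].
    { assert (-1 <= exp_sin x / c <= 1); [|lra]. split.
      - apply Rle_div_r; lra.
      - apply Rle_div_l; lra. }
    assert (Ht' := Rle_trans _ _ _ (Rmax_r _ _) Ht).
    exists t. split; [exact (Rle_trans _ _ _ (Rmax_l _ _) Ht)|].
    assert (Hy := HT0 t (Rle_trans _ _ _ (Rmax_l _ _) Ht')).
    assert (HF := HT1 t (Rle_trans _ _ _ (Rmax_r _ _) Ht')).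
    rewrite E in HF. replace (exp_sin (y t) + c * - (exp_sin x / c))
      with (exp_sin (y t) - exp_sin x) in HF by (field; lra).
    apply Rabs_lt_between in HF.
    assert (U := exp_sin_le_inv (y t) x (eps / 32) Hy Hx2 ltac:(lra) ltac:(lra)).
    assert (L := exp_sin_le_inv x (y t) (eps / 32) Hx2 Hy ltac:(lra) ltac:(lra)).
    apply Rabs_lt_between. lra.
Qed.

(** Past any time the phase still has to cross the solutions [asin q + 2 n PI] with [n] large,
    and it does so by the intermediate value theorem. *)
Lemma sin_unbounded_attains (theta : R -> R) :
  (forall t, 0 < t -> continuous theta t) ->
  (forall M, exists T, forall t, T <= t -> M <= theta t) ->
  forall q T, -1 <= q <= 1 -> exists t, T <= t /\ sin (theta t) = q.
Proof.
  intros Hc Hinf q T Hq.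
  set (T1 := Rmax T 1). assert (HT1 : 1 <= T1) by apply Rmax_r.
  assert (P := PI_RGT_0).
  destruct (nfloor_ex (Rmax 0 ((theta T1 - asin q) / (2 * PI)))) as [n [_ Hn]]; [apply Rmax_l|].
  rewrite <- S_INR in Hn.
  set (m := asin q + 2 * INR (S n) * PI).
  assert (Hm : theta T1 < m).
  { assert (A : (theta T1 - asin q) / (2 * PI) < INR (S n)) by (eapply Rle_lt_trans;
    [apply Rmax_r|exact Hn]).
    apply Rlt_div_l in A; [|lra]. unfold m. lra. }
  destruct (Hinf (m + 1)) as [T2 H2].
  set (T3 := Rmax (T1 + 1) T2).
  assert (H3 : m + 1 <= theta T3) by apply H2, Rmax_r.
  assert (H13 : T1 + 1 <= T3) by apply Rmax_l.
  destruct (IVT_interv (fun t => theta t - m) T1 T3) as [t [Ht E]].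
  - intros t Ht. apply continuity_pt_filterlim.
    apply (continuous_minus (V := R_NormedModule)); [apply Hc; lra|apply continuous_const].
  - lra.
  - lra.
  - lra.
  - exists t. split; [apply Rle_trans with T1; [apply Rmax_l|lra]|].
    replace (theta t) with m by lra. unfold m. rewrite sin_period. now apply sin_asin.
Qed.

(** * The argument along trajectories *)

Lemma Arg_eq_carg (z : C) : 0 < Re z -> Arg z = carg z.
Proof.
  intros H. assert (N := Re_pos_neq_0 z H). destruct (Arg_spec z N) as [B E].
  apply Cmod_gt_0 in N.
  assert (E1 : Re z = Cmod z * cos (Arg z)) by (rewrite E at 1; reflexivity).
  assert (E2 : Im z = Cmod z * sin (Arg z)) by (rewrite E at 1; reflexivity).
  assert (Hc : 0 < cos (Arg z)) by nra.
  assert (Hb : - (PI/2) < Arg z < PI/2).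
  { split; apply Rnot_le_lt; intros Hle.
    - assert (Q : cos (- Arg z) <= 0) by (apply cos_le_0; lra). rewrite cos_neg in Q. lra.
    - assert (Q : cos (Arg z) <= 0) by (apply cos_le_0; lra). lra. }
  unfold carg. rewrite E1, E2.
  replace (Cmod z * sin (Arg z) / (Cmod z * cos (Arg z))) with (tan (Arg z)) by (unfold tan; field;
  lra).
  now rewrite atan_tan.
Qed.

Lemma carg_inv (v : C) : 0 < Re v -> 0 < Re (/ v) /\ carg (/ v) = - carg v.
Proof.
  intros H. assert (N := Re_pos_neq_0 v H).
  assert (D : 0 < Re v ^ 2 + Im v ^ 2) by (rewrite <- Cmod2_alt; apply pow_lt, Cmod_gt_0, N).
  assert (E1 : Re (/ v) = Re v / (Re v ^ 2 + Im v ^ 2)) by reflexivity.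
  assert (E2 : Im (/ v) = - Im v / (Re v ^ 2 + Im v ^ 2)) by reflexivity.
  split.
  - rewrite E1. now apply Rdiv_lt_0_compat.
  - unfold carg. rewrite <- atan_opp. f_equal. rewrite E1, E2. field. lra.
Qed.

Lemma Im_koenigs_Omega (v : C) : 0 < Re v ->
  Im (koenigs_Omega v) =
    Cmod v * (sin (carg v) + amplitude * (exp (- carg v) * sin (ln (Cmod v) + carg v))).
Proof.
  intros H. unfold koenigs_Omega, perturbation. rewrite Im_plus, im_scal_l, cpow_1Ci.
  destruct (carg_polar v H) as [_ E]. rewrite E at 1.
  unfold cexp; simpl. unfold Rminus.
  rewrite exp_plus, exp_ln by (apply Cmod_gt_0, Re_pos_neq_0, H). ring.
Qed.

Definition flow_arg (v0 : C) (t : R) : R := carg (flow t v0).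
(** The argument of [v^(1+i)] at [v = flow t v0]. *)
Definition flow_phase (v0 : C) (t : R) : R := ln (Cmod (flow t v0)) + flow_arg v0 t.

(** The imaginary part of [koenigs_Omega] is a constant of motion. *)
Lemma trajectory_relation v0 t : Omega v0 -> 0 <= t ->
  Im (koenigs_Omega v0) =
    Cmod (flow t v0) * (sin (flow_arg v0 t) +
      amplitude * (exp (- flow_arg v0 t) * sin (flow_phase v0 t))).
Proof.
  intros Hv0 Ht. assert (A := flow_Omega t v0 Ht Hv0). unfold half_plane in A.
  unfold flow_phase, flow_arg. rewrite <- Im_koenigs_Omega by lra.
  rewrite koenigs_Omega_flow by auto. rewrite Im_plus, im_RtoC. ring.
Qed.

Lemma trajectory_escapes v0 M : Omega v0 ->
  exists T, 0 <= T /\ forall t, T <= t -> M <= Cmod (flow t v0).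
Proof.
  intros Hv0. exists (Rmax 0 (4 / 3 * (M + Cmod v0))). split; [apply Rmax_l|]. intros t Ht.
  assert (A := Rle_trans _ _ _ (Rmax_l _ _) Ht). assert (B := Rle_trans _ _ _ (Rmax_r _ _) Ht).
  generalize (flow_far t v0 A Hv0). lra.
Qed.

Lemma trajectory_continuous v0 t : Omega v0 -> 0 < t ->
  continuous (T := R_UniformSpace) (U := C_UniformSpace) (fun s => flow s v0) t.
Proof.
  intros Hv0 Ht. apply (filterlim_locally (U := C_UniformSpace)). intros eps.
  assert (He := cond_pos eps).
  assert (Hd : 0 < Rmin t (eps / 2)) by (apply Rmin_glb_lt; lra).
  exists (mkposreal _ Hd). intros s Hs. apply ball_of_Cmod.
  change (Rabs (s - t) < Rmin t (eps / 2)) in Hs.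
  assert (A := Rmin_l t (eps / 2)). assert (B := Rmin_r t (eps / 2)).
  assert (Hs0 : 0 <= s) by (apply Rabs_lt_between in Hs; lra).
  generalize (flow_lipschitz_time t s v0 (Rlt_le _ _ Ht) Hs0 Hv0). lra.
Qed.

Lemma flow_phase_continuous v0 t : Omega v0 -> 0 < t -> continuous (flow_phase v0) t.
Proof.
  intros Hv0 Ht. assert (A := flow_Omega t v0 (Rlt_le _ _ Ht) Hv0). unfold half_plane in A.
  apply (continuous_plus (V := R_NormedModule)).
  - apply (continuous_comp (U := R_UniformSpace) (V := C_UniformSpace) (fun s => flow s v0) (fun w => ln (Cmod w))).
    + now apply trajectory_continuous.
    + apply continuous_ln_Cmod, Re_pos_neq_0. lra.
  - apply (continuous_comp (U := R_UniformSpace) (V := C_UniformSpace) (fun s => flow s v0) carg).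
    + now apply trajectory_continuous.
    + apply continuous_carg. lra.
Qed.

Lemma flow_phase_unbounded v0 M : Omega v0 -> exists T, forall t, T <= t -> M <= flow_phase v0 t.
Proof.
  intros Hv0. destruct (trajectory_escapes v0 (exp (M + 2)) Hv0) as [T [_ H]]. exists T.
  intros t Ht.
  specialize (H t Ht). apply ln_le in H; [|apply exp_pos]. rewrite ln_exp in H.
  assert (B := carg_bound (flow t v0)). assert (P := PI_4). unfold flow_phase, flow_arg. lra.
Qed.

(** Dividing the constant of motion by [|flow t v0|], which tends to infinity. *)
Lemma trajectory_limit v0 eps : Omega v0 -> 0 < eps ->
  exists T, 0 <= T /\ forall t, T <= t ->
    Rabs (sin (flow_arg v0 t) + amplitude * (exp (- flow_arg v0 t) * sin (flow_phase v0 t))) < eps.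
Proof.
  intros Hv0 He. set (M := (Rabs (Im (koenigs_Omega v0)) + 1) / eps).
  assert (HM : 0 < M) by (apply Rdiv_lt_0_compat; auto;
  generalize (Rabs_pos (Im (koenigs_Omega v0))); lra).
  destruct (trajectory_escapes v0 M Hv0) as [T [HT H]]. exists T; split; auto. intros t Ht.
  specialize (H t Ht). assert (R := trajectory_relation v0 t Hv0 (Rle_trans _ _ _ HT Ht)).
  set (q := sin (flow_arg v0 t) + amplitude * (exp (- flow_arg v0 t) * sin (flow_phase v0 t))) in *.
  apply (f_equal Rabs) in R. rewrite Rabs_mult, (Rabs_right (Cmod _)) in R
    by (generalize (Cmod_ge_0 (flow t v0)); lra).
  apply Rmult_lt_reg_l with M; auto.
  apply Rle_lt_trans with (Cmod (flow t v0) * Rabs q); [apply Rmult_le_compat_r;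
  [apply Rabs_pos|auto]|].
  rewrite <- R. unfold M. replace ((Rabs (Im (koenigs_Omega v0)) + 1) / eps * eps)
    with (Rabs (Im (koenigs_Omega v0)) + 1) by (field; lra).
  lra.
Qed.

Lemma trajectory_exp_sin_limit v0 eps : Omega v0 -> 0 < eps ->
  exists T, forall t, T <= t ->
    Rabs (exp_sin (flow_arg v0 t) + amplitude * sin (flow_phase v0 t)) < eps.
Proof.
  intros Hv0 He. destruct (trajectory_limit v0 (eps / 9) Hv0) as [T [HT H]]; [lra|]. exists T.
  intros t Ht.
  specialize (H t Ht).
  assert (B := exp_le_9 (flow_arg v0 t) (carg_bound (flow t v0))).
  assert (P := exp_pos (flow_arg v0 t)).
  replace (exp_sin (flow_arg v0 t) + amplitude * sin (flow_phase v0 t)) with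
    (exp (flow_arg v0 t) * (sin (flow_arg v0 t) + amplitude * (exp (- flow_arg v0 t) * sin (flow_phase v0 t)))).
  - rewrite Rabs_mult, Rabs_right by lra.
    apply Rle_lt_trans
      with (9 * Rabs (sin (flow_arg v0 t) + amplitude * (exp (- flow_arg v0 t) * sin (flow_phase v0 t)))); [|lra].
    apply Rmult_le_compat_r; [apply Rabs_pos|auto].
  - unfold exp_sin. assert (E : exp (flow_arg v0 t) * exp (- flow_arg v0 t) = 1)
      by (rewrite <- exp_plus, Rplus_opp_r; apply exp_0).
    transitivity (exp (flow_arg v0 t) * sin (flow_arg v0 t) + amplitude * (exp (flow_arg v0 t) * exp (- flow_arg v0 t)) * sin (flow_phase v0 t)); [ring|].
    rewrite E. ring.
Qed.

(** In the limit relation the perturbation contributes at most [amplitude * 9], hence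
    [|sin (flow_arg v0 t)|] is eventually below [1/10 + 9/100 < 1/4 <= sin (1/2)]. This
    excludes the part of [(-PI/2, 0)] on which [exp_sin] decreases. *)
Lemma trajectory_arg_small v0 : Omega v0 ->
  exists T, forall t, T <= t -> Rabs (flow_arg v0 t) <= 1/2.
Proof.
  intros Hv0. destruct (trajectory_limit v0 (1/10) Hv0) as [T [HT H]]; [lra|]. exists T.
  intros t Ht. specialize (H t Ht).
  assert (Bd := carg_bound (flow t v0)). fold (flow_arg v0 t) in Bd.
  assert (B := exp_le_9 (- flow_arg v0 t) ltac:(lra)). assert (P := exp_pos (- flow_arg v0 t)).
  assert (Q : Rabs (amplitude * (exp (- flow_arg v0 t) * sin (flow_phase v0 t))) <= 9/100).
  { rewrite !Rabs_mult, (Rabs_right amplitude), (Rabs_right (exp _)) by (unfold amplitude; lra).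
    assert (S : Rabs (sin (flow_phase v0 t)) <= 1) by (apply Rabs_le;
    generalize (SIN_bound (flow_phase v0 t)); lra).
    assert (exp (- flow_arg v0 t) * Rabs (sin (flow_phase v0 t)) <= 9 * 1).
    { apply Rmult_le_compat; auto using Rabs_pos. lra. }
    unfold amplitude. lra. }
  apply Rabs_lt_between in H. apply Rabs_le_between in Q.
  apply Rabs_le. split; apply Rnot_lt_le; intros Hlt.
  - assert (S := sin_half_lower (- flow_arg v0 t) ltac:(lra)). rewrite sin_neg in S. lra.
  - assert (S := sin_half_lower (flow_arg v0 t) ltac:(lra)). lra.
Qed.

Lemma trajectory_arg_cluster v0 a b : Omega v0 -> Rabs a <= 1/2 -> Rabs b <= 1/2 ->
  exp_sin a = - amplitude -> exp_sin b = amplitude ->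
  forall x, cluster_set_at_infty (flow_arg v0) x <-> a <= x <= b.
Proof.
  intros. apply cluster_set_interval with (theta := flow_phase v0) (c := amplitude); auto.
  - unfold amplitude; lra.
  - intros eps He. now apply trajectory_exp_sin_limit.
  - now apply trajectory_arg_small.
  - apply sin_unbounded_attains.
    + intros t Ht. now apply flow_phase_continuous.
    + intros M. now apply flow_phase_unbounded.
Qed.

Lemma Arg_one_minus_disk_semigroup t z : 0 <= t -> unit_disk z ->
  Arg (1 - Cconj 1 * disk_semigroup t z) = - carg (flow t (to_Omega z)).
Proof.
  intros Ht Hz. assert (A := flow_Omega t _ Ht (to_Omega_disk z Hz)). unfold half_plane in A.
  replace (1 - Cconj 1 * disk_semigroup t z)%C with (/ flow t (to_Omega z))%C.
  - destruct (carg_inv (flow t (to_Omega z))) as [P E]; [lra|]. now rewrite Arg_eq_carg.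
  - unfold disk_semigroup. replace (Cconj 1) with (RtoC 1) by (unfold Cconj, RtoC; simpl; f_equal;
    ring). ring.
Qed.

(** The change of sign, and with it the exchange of [a] and [b], comes from [1 - z = 1 / v]. *)
Lemma slope_disk_semigroup a b : Rabs a <= 1/2 -> Rabs b <= 1/2 ->
  exp_sin a = - amplitude -> exp_sin b = amplitude ->
  forall z, unit_disk z -> forall x, slope disk_semigroup 1 z x <-> - b <= x <= - a.
Proof.
  intros Ha Hb Ea Eb z Hz x.
  assert (K := trajectory_arg_cluster (to_Omega z) a b (to_Omega_disk z Hz) Ha Hb Ea Eb (- x)).
  transitivity (a <= - x <= b); [|lra]. rewrite <- K. unfold slope. split; intros H.
  - apply cluster_set_opp in H.
    apply (cluster_set_ext (fun t => - Arg (1 - Cconj 1 * disk_semigroup t z))); auto.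
    intros t Ht. rewrite Arg_one_minus_disk_semigroup by auto. apply Ropp_involutive.
  - apply cluster_set_opp in H. rewrite Ropp_involutive in H.
    apply (cluster_set_ext (fun t => - carg (flow t (to_Omega z)))); auto.
    intros t Ht. now rewrite Arg_one_minus_disk_semigroup.
Qed.

Theorem proposition1p3 :
  exists (phi : R -> C -> C) (tau : C) (a b : R),
    parabolic_zero_hyperbolic_step phi /\
    denjoy_wolff_point phi tau /\
    - (PI / 2) < a /\ a < b /\ b < PI / 2 /\
    (forall z : C, unit_disk z ->
       forall theta : R, slope phi tau z theta <-> a <= theta <= b).
Proof.
  destruct (exp_sin_surj (- amplitude)) as [a [Ha Ea]]; [rewrite Rabs_Ropp, Rabs_right;
  unfold amplitude; lra|].
  destruct (exp_sin_surj amplitude) as [b [Hb Eb]]; [rewrite Rabs_right; unfold amplitude; lra|].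
  exists disk_semigroup, (RtoC 1), (- b), (- a).
  assert (Hab : a < b).
  { apply Rnot_le_lt. intros Hle. apply Rabs_le_between in Ha as Ha'.
    apply Rabs_le_between in Hb as Hb'.
    assert (E := exp_sin_expanding b a). unfold amplitude in *. lra. }
  apply Rabs_le_between in Ha as Ha'. apply Rabs_le_between in Hb as Hb'.
  assert (P := PI2_1).
  split; [apply disk_semigroup_parabolic|]. split; [apply disk_semigroup_denjoy_wolff|].
  do 3 (split; [lra|]). now apply slope_disk_semigroup.
Qed.
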